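(* Let $X$ be a fibrant concrete cubeset, $x_0\in X(0)$ and $n\ge1$. The set $\pi_n(X,x_0)$ of equivalence classes of $n$-spheres of $X$ based at $x_0$, with the multiplication $[a]*[b]=[a*b]$ defined by corner completion, is an abelian group.
   Context: The cube category $\Box$ has objects $\{0,1\}^n$ ($n\in\mathbb N_0$) and morphisms the maps $\{0,1\}^n\to\{0,1\}^m$ that are restrictions of affine linear maps $\mathbb Z^n\to\mathbb Z^m$. A cubeset is a presheaf of sets $X$ on $\Box$; $X(n)$ is its value on $\{0,1\}^n$ and $\Box^n$ the presheaf represented by $\{0,1\}^n$, so $X(n)=\mathrm{Hom}(\Box^n,X)$. For $n\ge1$, $1\le i\le n$, $\varepsilon_i\colon\Box^{n-1}\to\Box^n$ is induced by inserting a $0$ at coordinate $i$; the corner $\Lambda^n\subseteq\Box^n$ is the union of the images of the $\varepsilon_i$. $X$ is concrete if $X(n)\to X(0)^{\{0,1\}^n}$ is injective for all $n$; $X$ is fibrant if every map $\Lambda^n\to X$ extends to $\Box^n$, for all $n\ge1$. An $n$-sphere of $X$ based at $x_0$ is an $n$-cube $c\in X(n)$ whose restriction to $\Lambda^n$ is constant equal to $x_0$. Let $s\colon\Box^n\to\Box^{n+1}$ be induced by $(x_1,\dots,x_n)\mapsto(x_1,x_1,x_2,\dots,x_n)$. Two $n$-spheres $c,d$ are equivalent if there exist $e,f\in X(n+1)$ with $e|_{\Lambda^{n+1}}=f|_{\Lambda^{n+1}}$, $e\circ s=c$ and $f\circ s=d$ (for $X$ concrete fibrant this is an equivalence relation).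 $\pi_n(X,x_0)$ is the set of equivalence classes. Multiplication: given $n$-spheres $a,b$, there is a map $\Lambda^{n+1}\to X$ which is $a$ on $\varepsilon_1$, $b$ on $\varepsilon_2$ and constant $x_0$ on $\varepsilon_i$ for $3\le i\le n+1$. Choose a completion $\overline{a*b}\in X(n+1)$ of it and set $a*b=\overline{a*b}\circ s$. The class $[a*b]$ depends only on $[a]$ and $[b]$. *)

(* Defs.v *)
From Stdlib Require Export RelationClasses.
From mathcomp Require Export all_boot all_algebra.
From mathcomp Require Export boolp classical_sets.

Set Implicit Arguments.
Unset Strict Implicit.
Unset Printing Implicit Defensive.

Import GRing.Theory.

Definition cube (n : nat) : Type := {ffun 'I_n -> bool}.

Definition cube_point n (x : cube n) : 'rV[int]_n := (\row_j (x j)%:R)%R.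

Definition is_affine m n (f : cube m -> cube n) : Prop :=
  exists (A : 'M[int]_(m, n)) (b : 'rV[int]_n),
    forall x, cube_point (f x) = (cube_point x *m A + b)%R.

(* The morphisms {0,1}^m -> {0,1}^n of the cube category. *)
Record box (m n : nat) := Box {
  box_fun :> cube m -> cube n;
  boxP : is_affine box_fun
}.

Lemma box_ext m n (f g : box m n) : box_fun f =1 box_fun g -> f = g.
Proof.
case: f g => f fP [g gP] /= /funext fg.
by case: _ / fg gP => gP; rewrite (Prop_irrelevance fP gP).
Qed.

Lemma affine_id m : is_affine (@id (cube m)).
Proof.
exists 1%:M%R, 0%R => x; by rewrite mulmx1 addr0.
Qed.

Definition box_id m : box m m := Box (@affine_id m).

Lemma affine_comp l m n (f : box m n) (g : box l m) : is_affine (f \o g).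
Proof.
case: f g => f [A [b fE]] [g [B [c gE]]] /=.
exists (B *m A)%R, (c *m A + b)%R => x /=.
by rewrite fE gE mulmxDl mulmxA addrA.
Qed.

Definition box_comp l m n (f : box m n) (g : box l m) : box l n :=
  Box (affine_comp f g).

Lemma affine_select m n (h : 'I_n -> option 'I_m) (v : cube n) :
  is_affine (fun x : cube m =>
    [ffun k => if h k is Some j then x j else v k] : cube n).
Proof.
exists (\matrix_(j, k) (h k == Some j)%:R)%R,
       (\row_k (if h k is Some _ then 0 else (v k)%:R))%R => x.
apply/rowP => k; rewrite !mxE ffunE.
case hk: (h k) => [j|].
  rewrite addr0 (bigD1 j) //= !mxE hk eqxx mulr1 big1 ?addr0 // => i ij.
  by rewrite !mxE hk (inj_eq Some_inj) eq_sym (negbTE ij) mulr0.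
by rewrite big1 ?add0r // => i _; rewrite !mxE hk mulr0.
Qed.

Definition box_const m n (v : cube n) : box m n :=
  Box (affine_select (fun _ => @None 'I_m) v).

(* The map \varepsilon_i inserting a 0 at coordinate i. *)
Definition face_fun n (i : 'I_n) (x : cube n.-1) : cube n :=
  [ffun k => if unlift i k is Some j then x j else false].

Lemma affine_face n (i : 'I_n) : is_affine (face_fun i).
Proof.
have [A [b E]] := affine_select (unlift i) ([ffun=> false] : cube n).
exists A, b => x; rewrite -E; congr cube_point.
by apply/ffunP => k; rewrite !ffunE; case: unlift => //; rewrite ffunE.
Qed.

Definition face n (i : 'I_n) : box n.-1 n := Box (affine_face i).

(* The map s, (x_1, ..., x_n) |-> (x_1, x_1, x_2, ..., x_n): coordinates are
   numbered from 0 here, so coordinate k of the image is coordinate k.-1 of x.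
   When 0 < n one has k.-1 < n for every k : 'I_n.+1 and the default value
   false is never used. *)
Definition dup_fun n (x : cube n) : cube n.+1 :=
  [ffun k : 'I_n.+1 => if insub (nat_of_ord k).-1 is Some j then x j else false].

Lemma affine_dup n : is_affine (@dup_fun n).
Proof.
have [A [b E]] := affine_select
  (fun k : 'I_n.+1 => insub (nat_of_ord k).-1 : option 'I_n) [ffun=> false].
exists A, b => x; rewrite -E; congr cube_point.
by apply/ffunP => k; rewrite !ffunE; case: insub => //; rewrite ffunE.
Qed.

Definition dup n : box n n.+1 := Box (@affine_dup n).

Record cubeset := Cubeset {
  cubes :> nat -> Type;
  restr : forall m n, box m n -> cubes n -> cubes m;
  restr_id : forall n (c : cubes n), restr (box_id n) c = c;
  restr_comp : forall l m n (f : box m n) (g : box l m) (c : cubes n),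
    restr (box_comp f g) c = restr g (restr f c)
}.

Record cubemap (X Y : cubeset) := Cubemap {
  cubemap_fun :> forall n, X n -> Y n;
  cubemap_nat : forall m n (f : box m n) (c : X n),
    cubemap_fun (restr f c) = restr f (cubemap_fun c)
}.

Lemma cubemap_ext X Y (F G : cubemap X Y) :
  (forall n (c : X n), F n c = G n c) -> F = G.
Proof.
case: F G => F FP [G GP] /= FG.
have E : F = G by apply: functional_extensionality_dep => n; apply/funext.
by case: _ / E GP => GP; rewrite (Prop_irrelevance FP GP).
Qed.

Lemma cubemap_comp_nat X Y Z (G : cubemap Y Z) (F : cubemap X Y)
    m n (f : box m n) (c : X n) :
  G m (F m (restr f c)) = restr f (G n (F n c)).
Proof. by rewrite !cubemap_nat. Qed.

Definition cubemap_comp X Y Z (G : cubemap Y Z) (F : cubemap X Y) :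
    cubemap X Z :=
  Cubemap (cubemap_comp_nat G F).

Lemma representable_id n k (f : box k n) : box_comp f (box_id k) = f.
Proof. exact: box_ext. Qed.

Lemma representable_comp n l m k (f : box m k) (g : box l m) (h : box k n) :
  box_comp h (box_comp f g) = box_comp (box_comp h f) g.
Proof. exact: box_ext. Qed.

Definition representable (n : nat) : cubeset :=
  @Cubeset (fun k => box k n) (fun l k f h => box_comp h f)
    (@representable_id n) (@representable_comp n).

Definition in_corner n k (f : box k n) : Prop :=
  exists (i : 'I_n) (g : box k n.-1), f = box_comp (face i) g.

Lemma in_corner_comp n l k (g : box l k) (f : box k n) :
  in_corner f -> in_corner (box_comp f g).
Proof.
by move=> [i [h ->]]; exists i, (box_comp h g); apply: box_ext.
Qed.

Definition corner_cubes n k : Type := {f : box k n | in_corner f}.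

Definition corner_restr n l k (g : box l k) (f : corner_cubes n k) :
    corner_cubes n l :=
  exist _ (box_comp (sval f) g) (in_corner_comp g (svalP f)).

Lemma corner_cubes_ext n k (f g : corner_cubes n k) : sval f = sval g -> f = g.
Proof.
case: f g => f fP [g gP] /= fg; case: _ / fg gP => gP.
by rewrite (Prop_irrelevance fP gP).
Qed.

Lemma corner_restr_id n k (f : corner_cubes n k) : corner_restr (box_id k) f = f.
Proof. exact/corner_cubes_ext/box_ext. Qed.

Lemma corner_restr_comp n l m k (f : box m k) (g : box l m)
    (h : corner_cubes n k) :
  corner_restr (box_comp f g) h = corner_restr g (corner_restr f h).
Proof. exact/corner_cubes_ext/box_ext. Qed.

Definition corner (n : nat) : cubeset :=
  @Cubeset (corner_cubes n) (@corner_restr n)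
    (@corner_restr_id n) (@corner_restr_comp n).

Definition corner_incl n : cubemap (corner n) (representable n) :=
  @Cubemap (corner n) (representable n) (fun k f => sval f)
    (fun _ _ _ _ => erefl).

Lemma face_in_corner n (i : 'I_n) : in_corner (face i).
Proof. by exists i, (box_id _); apply: box_ext. Qed.

(* \varepsilon_i as an (n-1)-cube of the corner. *)
Definition corner_face n (i : 'I_n) : corner n n.-1 :=
  exist _ (face i) (face_in_corner i).

(* The map classified by c under the Yoneda identification
   X n = Hom (representable n, X). *)
Definition yoneda (X : cubeset) n (c : X n) : cubemap (representable n) X :=
  @Cubemap (representable n) X (fun k f => restr f c)
    (fun m k f g => restr_comp g f c).

Definition on_corner (X : cubeset) n (c : X n) : cubemap (corner n) X :=
  cubemap_comp (yoneda c) (corner_incl n).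

Definition concrete (X : cubeset) : Prop :=
  forall n, injective (fun (c : X n) (v : cube n) => restr (box_const 0 v) c).

Definition fibrant (X : cubeset) : Prop :=
  forall n, 0 < n -> forall phi : cubemap (corner n) X,
    exists psi : cubemap (representable n) X,
      cubemap_comp psi (corner_incl n) = phi.

Definition const_cube (X : cubeset) (x0 : X 0) n : X n :=
  restr (box_const n ([ffun=> false] : cube 0)) x0.

Lemma restr_const_cube (X : cubeset) (x0 : X 0) m n (f : box m n) :
  restr f (const_cube x0 n) = const_cube x0 m.
Proof.
rewrite /const_cube -restr_comp; congr restr.
by apply: box_ext => x; apply/ffunP => -[].
Qed.

Definition const_map (X Y : cubeset) (x0 : Y 0) : cubemap X Y :=
  @Cubemap X Y (fun n _ => const_cube x0 n)
    (fun m n f _ => esym (restr_const_cube x0 f)).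

Section Spheres.
Variables (X : cubeset) (x0 : X 0) (n : nat).

Definition is_sphere (c : X n) : Prop :=
  on_corner c = const_map (corner n) x0.

Definition sphere : Type := {c : X n | is_sphere c}.

Definition sphere_equiv (c d : sphere) : Prop :=
  exists e f : X n.+1,
    [/\ on_corner e = on_corner f,
        restr (dup n) e = sval c &
        restr (dup n) f = sval d].

Definition sphere_class (c : sphere) : set sphere :=
  [set d | sphere_equiv c d].

(* \pi_n(X, x0), for 0 < n. *)
Definition homotopy_set : Type :=
  {C : set sphere | exists c, C = sphere_class c}.

Definition homotopy_class (c : sphere) : homotopy_set :=
  exist _ (sphere_class c) (ex_intro _ c erefl).

Definition is_product_corner (a b : sphere) (phi : cubemap (corner n.+1) X) :
    Prop :=
  forall i : 'I_n.+1,
    phi n (corner_face i) =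
      match nat_of_ord i with
      | 0 => sval a
      | 1 => sval b
      | _ => const_cube x0 n
      end.

Definition product_completion (a b : sphere) (e : X n.+1) : Prop :=
  exists2 phi : cubemap (corner n.+1) X,
    is_product_corner a b phi & on_corner e = phi.

(* The completion of the corner is a choice, so the law on classes is
   characterised by [a] * [b] = [e \o s] for all completions e; the first
   clause makes this a specification of all the values of mul. *)
Definition is_completion_product
    (mul : homotopy_set -> homotopy_set -> homotopy_set) : Prop :=
  (forall a b, exists e, product_completion a b e) /\
  (forall a b e, product_completion a b e ->
     exists2 c : sphere, sval c = restr (dup n) e &
       mul (homotopy_class a) (homotopy_class b) = homotopy_class c).

End Spheres.

Definition is_abelian_group (T : Type) (mul : T -> T -> T) : Prop :=
  [/\ associative mul,
      commutative mul &
      exists (one : T) (inv : T -> T),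
        left_id one mul /\ left_inverse one inv mul].

(* Main.v *)
Require Import Defs.
From mathcomp Require Import perm zify.

Set Implicit Arguments.
Unset Strict Implicit.
Unset Printing Implicit Defensive.

(** A cube of a concrete cubeset is a function on the vertices, and the only
    source of new cubes is the completion of corners. Filling in one vertex at a
    time, a function defined on a down-set of the discrete cube extends to a
    cube as soon as it is a cube below each point of the down-set
    ([extend_downset]). Applied to an L-shaped down-set, this shows that two
    cubes with a common face can be glued ([glue]).

    Gluing is all that the group laws need. A sphere is determined by its value
    [p] at the top vertex. Write [p q; r s] for the (n+1)-cube whose values at
    the points with last n-1 coordinates equal to 1 are [p], [q], [r], [s],
    according to the first two coordinates, and whose other values are [x0].
    Such squares are 2-cubes of an iterated loop object of [X], so they may be
    reflected, transposed, and glued along rows and columns, as in a double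
    groupoid. The spheres [a] and [b] have product [c] when [x0 a; b c] is a
    cube, and are equivalent when [x0 a; x0 b] is one. Commutativity is
    transposition, the unit is a degenerate square, inverses come from corner
    completion, and associativity ([sq_assoc]) and independence of
    representatives ([sq_unique]) are gluings of two or three squares.

    It remains to identify the equivalence of spheres with the existence of a
    square [x0 a; x0 b]. The former gives two (n+1)-cubes that differ only at
    the top vertex and are otherwise unknown. By gluing along one coordinate
    after another, such a pair can be replaced by a pair in which all the other
    vertices have the same value as the top vertex of the first cube, and this
    process can be reversed towards any other cube with the same top value
    ([set_top_transport]). *)

Import GRing.Theory.

(** * Maps of the cube category by coordinates *)

(** An affine function with values 0 and 1 on the discrete cube depends on at
    most one variable, so these are the coordinates of the maps of cubes. *)
Definition literal m (t : cube m -> bool) : Prop :=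
  exists (o : option 'I_m) (b : bool),
    forall x, t x = (if o is Some j then x j else false) (+) b.

Lemma literal_comp l m (t : cube m -> bool) (f : cube l -> cube m) :
  literal t -> (forall j, literal (fun x => f x j)) -> literal (t \o f).
Proof.
move=> [[j|] [b tE]] litf; last by exists None, b => x; rewrite /= tE.
have [o [b' fE]] := litf j; exists o, (b' (+) b) => x.
by rewrite /= tE fE addbA.
Qed.

Lemma literal_face n (i j : 'I_n) : literal (fun x => face i x j).
Proof. by exists (unlift i j), false => x; rewrite addbF /= ffunE. Qed.

Lemma affine_literals m n (f : cube m -> cube n) :
  (forall k, literal (fun x => f x k)) -> is_affine f.
Proof.
move=> litf.
have /choice[h hE] k : exists ob : option 'I_m * bool, forall x,
    f x k = (if ob.1 is Some j then x j else false) (+) ob.2.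
  by have [o [b E]] := litf k; exists (o, b).
exists (\matrix_(j, k) (((h k).1 == Some j)%:R * (-1) ^+ (h k).2))%R,
       (\row_k (h k).2%:R)%R => x.
apply/rowP => k; rewrite !mxE hE.
case hk: (h k) => [[j|] b] /=; last first.
  by rewrite big1 ?add0r // => i _; rewrite !mxE hk mul0r mulr0.
rewrite (bigD1 j) //= !mxE hk eqxx mul1r big1 ?addr0 => [|i ij].
  by case: (x j); case: (b);
    rewrite ?mul0r ?mul1r ?add0r ?addr0 ?subrr.
by rewrite !mxE hk (inj_eq Some_inj) eq_sym (negbTE ij) mul0r mulr0.
Qed.

(** * Points of the discrete cube *)

Definition top n : cube n := [ffun=> true].

Definition meet n (x z : cube n) : cube n := [ffun k => x k && z k].

Lemma meet_top n (x : cube n) : meet x (top n) = x.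
Proof. by apply/ffunP => k; rewrite !ffunE andbT. Qed.

Lemma neq_top n (v : cube n) : v != top n -> exists i, v i = false.
Proof.
move=> vtop; suff [i /negbTE vi] : exists i, ~~ v i by exists i.
apply/existsP; apply: contraNT vtop => /existsPn vT.
by apply/eqP/ffunP => k; rewrite ffunE; apply/negbNE/vT.
Qed.

Lemma face_neq_top n (i : 'I_n) (x : cube n.-1) : face i x != top n.
Proof. by apply/eqP => /ffunP/(_ i); rewrite !ffunE unlift_none. Qed.

Lemma face_surj n (i : 'I_n) (v : cube n) :
  v i = false -> exists x, v = face i x.
Proof.
move=> vi; exists [ffun j => v (lift i j)]; apply/ffunP => k.
by rewrite ffunE; case: unliftP => [j|] ->; rewrite ?ffunE.
Qed.

Definition set_coord n (k : 'I_n) (b : bool) (x : cube n) : cube n :=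
  [ffun j => if j == k then b else x j].

Lemma set_coord_id n (k : 'I_n) (x : cube n) : set_coord k (x k) x = x.
Proof. by apply/ffunP => j; rewrite ffunE; case: eqP => [->|]. Qed.

Lemma set_coordE n (k : 'I_n) b (x : cube n) : set_coord k b x k = b.
Proof. by rewrite ffunE eqxx. Qed.

Lemma set_coordK n (k : 'I_n) b c (x : cube n) :
  set_coord k b (set_coord k c x) = set_coord k b x.
Proof. by apply/ffunP => j; rewrite !ffunE; case: eqP. Qed.

Lemma coord_top n (k : 'I_n) (x : cube n) : x k = false -> (x == top n) = false.
Proof. by move=> xk; apply/eqP => /ffunP/(_ k); rewrite ffunE xk. Qed.

(** In a square of spheres the first two coordinates vary freely and all the
    others are 1, so both edges and squares are supported on such sets. *)
Definition ones_from n (d : nat) (x : cube n) : bool :=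
  [forall k : 'I_n, (d <= k) ==> x k].

Lemma ones_fromP n d (x : cube n) :
  reflect (forall k : 'I_n, d <= k -> x k) (ones_from d x).
Proof. exact/'forall_implyP. Qed.

Lemma ones_from0 n (x : cube n) : ones_from 0 x = (x == top n).
Proof.
apply/ones_fromP/eqP => [xT|-> k _]; last by rewrite ffunE.
by apply/ffunP => k; rewrite ffunE; apply: xT.
Qed.

Lemma ones_from_ord n (k : 'I_n) (x : cube n) :
  ones_from k x = x k && ones_from k.+1 x.
Proof.
apply/ones_fromP/andP => [xk|[xk /ones_fromP xS] j].
  by split; [apply: xk | apply/ones_fromP => j /ltnW; apply: xk].
by rewrite leq_eqVlt => /orP[/eqP/ord_inj<-|/xS].
Qed.

Lemma ones_from_face n (i : 'I_n) d (x : cube n.-1) :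
  i <= d -> ones_from d.+1 (face i x) = ones_from d x.
Proof.
move=> id; apply/ones_fromP/ones_fromP => xd k.
  move=> dk; have /= := xd (lift i k); rewrite ffunE liftK; apply.
  by rewrite /= /bump (leq_trans id dk).
rewrite /= ffunE; case: unliftP => [j|] -> /=; last by rewrite ltnNge id.
rewrite /bump => dj; apply: xd; lia.
Qed.

Lemma ones_from_face_lt n (i : 'I_n) d (x : cube n.-1) :
  d <= i -> ones_from d (face i x) = false.
Proof.
move=> di; apply/negP => /ones_fromP/(_ i di).
by rewrite ffunE unlift_none.
Qed.

Lemma ones_from_ext n d (x y : cube n) :
  (forall k : 'I_n, d <= k -> x k = y k) -> ones_from d x = ones_from d y.
Proof.
move=> xy; apply/ones_fromP/ones_fromP => H k dk.
  by rewrite -xy // H.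
by rewrite xy // H.
Qed.

(** * Vertices and cubes of a cubeset *)

Section Vertices.
Variable X : cubeset.

Definition vertex n (c : X n) (v : cube n) : X 0 := restr (box_const 0 v) c.

Lemma vertex_restr m n (f : box m n) (c : X n) v :
  vertex (restr f c) v = vertex c (f v).
Proof.
rewrite /vertex -restr_comp; congr restr; apply: box_ext => x /=.
have -> : ([ffun k => v k] : cube m) = v by apply/ffunP => k; rewrite ffunE.
by apply/ffunP => k; rewrite ffunE.
Qed.

Lemma vertex_point (c : X 0) v : vertex c v = c.
Proof.
rewrite /vertex -[RHS]restr_id; congr restr; apply: box_ext => x.
by apply/ffunP => -[].
Qed.

Lemma vertex_const_cube (x0 : X 0) n v : vertex (const_cube x0 n) v = x0.
Proof. by rewrite /vertex restr_const_cube; apply: vertex_point. Qed.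

(** In a concrete cubeset a cube is the same thing as its vertices; all
    constructions below are made on functions on vertices. *)
Definition is_cube n (F : cube n -> X 0) : Prop :=
  exists c : X n, vertex c =1 F.

Lemma is_cube_const (x0 : X 0) n : is_cube (fun _ : cube n => x0).
Proof. by exists (const_cube x0 n) => v; apply: vertex_const_cube. Qed.

Lemma is_cube_pullback m n (f : cube m -> cube n) (F : cube n -> X 0) G :
  (forall k, literal (fun x => f x k)) -> is_cube F -> G =1 F \o f -> is_cube G.
Proof.
move=> /affine_literals affF [c cE] GE; exists (restr (Box affF) c) => v.
by rewrite vertex_restr cE GE.
Qed.

Lemma is_cube_flip n (k : 'I_n) (F : cube n -> X 0) :
  is_cube F -> is_cube (fun x => F (set_coord k (~~ x k) x)).
Proof.
move=> cF; apply: (is_cube_pullback _ cF) (frefl _) => j.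
exists (Some j), (j == k) => x.
by rewrite ffunE; case: eqP => [->|_]; rewrite ?addbT ?addbF.
Qed.

Hypothesis concX : concrete X.

Lemma vertex_inj n (c d : X n) : vertex c =1 vertex d -> c = d.
Proof. by move=> cd; apply: concX; apply/funext. Qed.

(** The corner contains every point except [top], by [face_surj]. *)
Lemma on_corner_eqP n (c d : X n) :
  on_corner c = on_corner d <->
  (forall v, v != top n -> vertex c v = vertex d v).
Proof.
split=> [cd v /neq_top[i /face_surj[x ->]]|cd].
  rewrite -!vertex_restr.
  by have /(congr1 (fun F : cubemap (corner n) X => F _ (corner_face i))) := cd => /= ->.
apply: cubemap_ext => k [f [i [g fE]]] /=.
by apply: vertex_inj => v; rewrite !vertex_restr fE; apply/cd/face_neq_top.
Qed.

Lemma on_corner_const (x0 : X 0) n :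
  on_corner (const_cube x0 n) = const_map (corner n) x0.
Proof. by apply: cubemap_ext => k f /=; rewrite restr_const_cube. Qed.

Lemma is_sphereP (x0 : X 0) n (c : X n) :
  is_sphere x0 c <-> forall v, v != top n -> vertex c v = x0.
Proof.
rewrite /is_sphere -on_corner_const on_corner_eqP.
by split=> cE v /cE; rewrite vertex_const_cube.
Qed.

(** * Completing corners and down-sets *)

Hypothesis fibX : fibrant X.

(** The faces need not be given as compatible cubes: by concreteness, functions
    on vertices that are cubes on each face glue to a map from the corner. *)
Lemma corner_completion n (F : cube n -> X 0) :
  (forall i, is_cube (F \o face i)) ->
  exists2 G, is_cube G & forall v, v != top n -> G v = F v.
Proof.
case: n F => [|n] F faceF.
  exists F => //; exists (F (top 0)) => v; rewrite vertex_point.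
  by congr F; apply/ffunP => -[].
have phiE k (f : box k n.+1) : exists c : X k,
    in_corner f -> vertex c =1 F \o f.
  have [[i [g ->]]|ncf] := pselect (in_corner f).
    have [c cE] := faceF i; exists (restr g c) => _ v.
    by rewrite vertex_restr cE.
  by exists (const_cube (F (top _)) k).
pose phi k (f : corner n.+1 k) : X k := sval (cid (phiE k (sval f))).
have phiP k (f : corner n.+1 k) : vertex (phi k f) =1 F \o sval f.
  by rewrite /phi; case: cid => h /= hE; apply/hE/(svalP f).
have phi_nat l k (g : box l k) (f : corner n.+1 k) :
    phi l (restr g f) = restr g (phi k f).
  by apply: vertex_inj => v; rewrite vertex_restr !phiP.
have [//|psi psiE] := fibX _ (Cubemap phi_nat).
exists (vertex (psi _ (box_id n.+1))) => [|v /neq_top[i /face_surj[x ->]]].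
  by exists (psi _ (box_id n.+1)).
rewrite -vertex_restr -cubemap_nat.
have -> : restr (face i) (box_id n.+1 : representable n.+1 n.+1) = face i.
  exact: box_ext.
have /(congr1 (fun H : cubemap (corner n.+1) X => H _ (corner_face i))) /= -> := psiE.
by rewrite phiP.
Qed.

(** The points below [z] form a cube whose dimension is the number of
    coordinates equal to 1 in [z]. *)
Section Subcube.
Variables (n : nat) (z : cube n).
Let A := [set k | z k].

Definition subcube_incl (t : cube #|A|) : cube n :=
  [ffun j => if [pick i | enum_val i == j] is Some i then t i else false].

Definition subcube_proj (y : cube n) : cube #|A| := [ffun i => y (enum_val i)].

Lemma literal_subcube_incl j : literal (fun t => subcube_incl t j).
Proof.
exists [pick i : 'I_#|A| | enum_val i == j], false => t.
by rewrite addbF ffunE; case: pickP.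
Qed.

Lemma literal_subcube_proj i : literal (fun y => subcube_proj y i).
Proof. by exists (Some (enum_val i)), false => y; rewrite ffunE addbF. Qed.

Lemma subcube_inclE t i : subcube_incl t (enum_val i) = t i.
Proof.
rewrite ffunE; case: pickP => [k /eqP/enum_val_inj->//|/(_ i)].
by rewrite eqxx.
Qed.

Lemma subcube_incl_le t j : subcube_incl t j -> z j.
Proof.
rewrite ffunE; case: pickP => [i /eqP<- _|//].
by have := enum_valP i; rewrite inE.
Qed.

Lemma subcube_projK y : subcube_incl (subcube_proj y) = meet y z.
Proof.
apply/ffunP => j; rewrite [RHS]ffunE.
have [zj|zj] := boolP (z j); last first.
  by rewrite andbF; apply: contraNF zj; apply: subcube_incl_le.
have jA : j \in A by rewrite inE.
by rewrite andbT -(enum_rankK_in jA jA) subcube_inclE ffunE.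
Qed.

Lemma subcube_proj_top y : (subcube_proj y == top _) = (meet y z == z).
Proof.
apply/eqP/eqP => [yt|yz].
  rewrite -subcube_projK yt -[RHS]meet_top.
  transitivity (meet (top n) z); last first.
    by apply/ffunP => j; rewrite !ffunE andbC.
  by rewrite -subcube_projK; congr subcube_incl; apply/ffunP => i; rewrite !ffunE.
apply/ffunP => i; rewrite !ffunE.
have : z (enum_val i) by have := enum_valP i; rewrite inE.
by rewrite -yz ffunE => /andP[].
Qed.

End Subcube.

(** Missing points are added one at a time. All the points strictly below a
    minimal missing point [z] are present, so they form a corner of the subcube
    below [z], and a completion of this corner provides a value at [z]. *)
Lemma extend_downset n (D : pred (cube n)) (F : cube n -> X 0) :
  (forall x z, D z -> D (meet x z)) ->
  (forall z, D z -> is_cube (fun x => F (meet x z))) ->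
  exists2 G, is_cube G & forall v, D v -> G v = F v.
Proof.
have [m] := ubnP #|[pred z | ~~ D z]|; elim: m D F => // m IHm D F.
rewrite ltnS => Dm Dmeet DF.
have [[z0 Dz0]|allD] := pselect (exists z, ~~ D z); last first.
  have DT v : D v by apply: contrapT => /negP Dv; apply: allD; exists v.
  exists F => //; have [c cE] := DF (top n) (DT _); exists c => v.
  by rewrite cE meet_top.
pose z := [arg min_(z < z0 | ~~ D z) #|[set k | z k]|].
have [Dz zmin] : ~~ D z /\
    forall y, ~~ D y -> #|[set k | z k]| <= #|[set k | y k]|.
  by rewrite /z; case: arg_minnP => // y Dy miny; split.
have below (y : cube n) : (forall k, y k -> z k) -> y != z -> D y.
  move=> yz; apply: contraNT => /zmin; rewrite leqNgt => zy.
  apply/eqP/ffunP => k; apply/idP/idP => [/yz//|zk].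
  apply: contraNT zy => yk; apply/proper_card/properP; split.
    by apply/fintype.subsetP => j; rewrite !inE; apply: yz.
  by exists k; rewrite inE // yk.
have [|G [c cE] GF] := corner_completion (F := F \o subcube_incl (z := z)).
  (* A face of the subcube is the set of points below its own top vertex. *)
  move=> i; pose w := subcube_incl (face i (top _)) : cube n.
  have Dw : D w.
    apply: below => [k|]; first exact: subcube_incl_le.
    apply/eqP => /ffunP/(_ (enum_val i)).
    rewrite subcube_inclE ffunE unlift_none.
    by have := enum_valP i; rewrite inE => ->.
  apply: (is_cube_pullback (f := subcube_incl (z := z) \o face i) _ (DF w Dw)).
    move=> k; apply: literal_comp (literal_subcube_incl z k) _ => j.
    exact: literal_face.
  move=> t /=; congr F; apply/ffunP => j; rewrite [RHS]ffunE.
  rewrite /w !ffunE; case: pickP => // k _; rewrite !ffunE.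
  by case: unlift => // l; rewrite ffunE andbT.
pose F' (y : cube n) := if y == z then G (top _) else F y.
have F'D y : D y -> F' y = F y.
  by rewrite /F'; case: eqP => // -> Dz'; rewrite Dz' in Dz.
have [|||H cH HF'] := IHm [pred y | D y || (y == z)] F'.
- apply: leq_trans Dm; apply/proper_card/properP; split.
    by apply/fintype.subsetP => y; rewrite !inE negb_or => /andP[].
  by exists z; rewrite !inE // eqxx orbT.
- move=> x y /= /orP[Dy|/eqP->]; first by rewrite Dmeet.
  have [_|xz] := eqVneq (meet x z) z; first by rewrite orbT.
  by rewrite below // => k; rewrite ffunE => /andP[].
- move=> y /= /orP[Dy|/eqP->].
    have [d dE] := DF y Dy; exists d => x.
    by rewrite dE F'D // Dmeet.
  apply: (is_cube_pullback (f := subcube_proj z) _ (ex_intro _ c cE)).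
    exact: literal_subcube_proj.
  move=> x /=; rewrite /F' -subcube_proj_top.
  have [->//|xt] := eqVneq; rewrite GF //=.
  by rewrite subcube_projK.
by exists H => // v Dv; rewrite HF' ?F'D //= Dv.
Qed.

(** * Gluing cubes and changing the top vertex *)

(** Two cubes [F] and [G] with a common face form an L-shaped down-set in a cube
    with one more coordinate: [F] on the face where coordinate [k] is 0, and [G]
    on the face where the new coordinate is 0. After extension to the whole
    cube, the glued cube is the diagonal slice in which the new coordinate is
    the negation of coordinate [k]; it meets only points of the L. *)
Lemma glue n (k : 'I_n) (F G : cube n -> X 0) :
  is_cube F -> is_cube G ->
  (forall x, F (set_coord k true x) = G (set_coord k false x)) ->
  is_cube (fun x => if x k then G x else F x).
Proof.
move=> cF cG FG.
pose tl (y : cube n.+1) : cube n := [ffun j => y (lift ord0 j)].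
pose K (y : cube n.+1) := if y ord0 then F (tl y) else G (tl y).
have [||H cH HK] := @extend_downset n.+1
    (fun y => ~~ (y ord0 && tl y k)) K.
- move=> x z; rewrite !ffunE.
  by apply: contra => /andP[/andP[_ ->] /andP[_ ->]].
- move=> z; rewrite negb_and ffunE => /orP[/negbTE z0|/negbTE zk].
    apply: (is_cube_pullback (f := fun y => tl (meet y z)) _ cG).
      move=> j; exists (if z (lift ord0 j) then Some (lift ord0 j) else None), false.
      by move=> x; rewrite !ffunE addbF; case: (z _); rewrite ?andbT ?andbF.
    by move=> x /=; rewrite /K ffunE z0 andbF.
  (* Below [z] the function [K] is [F] along the new coordinate, reversed,
     because the common face is the face [k = 1] of [F]. *)
  apply: (is_cube_pullback
    (f := fun y => set_coord k (~~ (y ord0 && z ord0)) (tl (meet y z))) _ cF).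
    move=> j; have [->|jk] := eqVneq j k.
      exists (if z ord0 then Some ord0 else None), true => x.
      by rewrite !ffunE eqxx addbT; case: (z _); rewrite ?andbT ?andbF.
    exists (if z (lift ord0 j) then Some (lift ord0 j) else None), false.
    move=> x; rewrite !ffunE (negbTE jk) addbF.
    by case: (z _); rewrite ?andbT ?andbF.
  have mk x : tl (meet x z) k = false by rewrite !ffunE zk andbF.
  move=> x /=; rewrite /K [meet x z ord0]ffunE; case: (_ && _) => /=.
    by rewrite -[in RHS](mk x) set_coord_id.
  by rewrite FG -[in RHS](mk x) set_coord_id.
pose diag (x : cube n) : cube n.+1 :=
  [ffun j => if unlift ord0 j is Some i then x i else ~~ x k].
have tld x : tl (diag x) = x by apply/ffunP => j; rewrite !ffunE liftK.
have d0 x : diag x ord0 = ~~ x k by rewrite ffunE unlift_none.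
apply: (is_cube_pullback (f := diag) _ cH) => [j|x /=].
  exists (if unlift ord0 j is Some i then Some i else Some k), (unlift ord0 j == None).
  by move=> x; rewrite ffunE; case: unlift => [i|] /=; rewrite ?addbF ?addbT.
by rewrite HK /K d0 tld; [case: (x k) | rewrite andNb].
Qed.

Definition set_top n (F : cube n -> X 0) (p : X 0) (v : cube n) : X 0 :=
  if v == top n then p else F v.

(** The function [F \o set_coord k true] is [F] on the face [k = 1], repeated on
    the face [k = 0]. Each of the two cubes with changed top vertex is obtained
    from the other by gluing it to a copy of [F]. *)
Lemma set_top_stretch n (k : 'I_n) (F : cube n -> X 0) p :
  is_cube F ->
  is_cube (set_top F p) <-> is_cube (set_top (F \o set_coord k true) p).
Proof.
move=> cF; split=> cFp.
  pose L (x : cube n) := F (set_coord k (~~ x k) x).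
  have cL : is_cube L by exact: is_cube_flip.
  have LF x : L (set_coord k true x) = set_top F p (set_coord k false x).
    rewrite /L /set_top set_coordE set_coordK.
    by rewrite (coord_top (set_coordE _ _ _)).
  have [c cE] := glue cL cFp LF; exists c => x; rewrite cE /set_top /L /=.
  case xk: (x k) => /=; last by rewrite (coord_top xk).
  by rewrite -[in set_coord _ _ _]xk set_coord_id.
have FU x : F (set_coord k true x) =
    set_top (F \o set_coord k true) p (set_coord k false x).
  by rewrite /set_top (coord_top (set_coordE _ _ _)) /= set_coordK.
have [c cE] := glue cF cFp FU; exists c => x; rewrite cE /set_top /=.
case xk: (x k) => /=; last by rewrite (coord_top xk).
by rewrite -[in set_coord _ _ _]xk set_coord_id.
Qed.

(** Stretching along all coordinates makes [F] constant. *)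
Lemma set_top_const n (F : cube n -> X 0) p :
  is_cube F -> is_cube (set_top F p) <-> 
  is_cube (set_top (fun _ : cube n => F (top n)) p).
Proof.
move=> cF.
pose raise (s : seq 'I_n) (x : cube n) : cube n := [ffun j => (j \in s) || x j].
have raise_cons k s x : raise (k :: s) x = raise s (set_coord k true x).
  by apply/ffunP => j; rewrite !ffunE inE; case: eqP; rewrite ?orbT.
have craise s : is_cube (F \o raise s).
  apply: (is_cube_pullback _ cF) (frefl _) => j.
  exists (if j \in s then None else Some j), (j \in s) => x.
  by rewrite ffunE; case: (j \in s); rewrite ?addbF.
have step s : is_cube (set_top F p) <-> is_cube (set_top (F \o raise s) p).
  elim: s => [|k s IHs].
    suff -> : F \o raise [::] = F by [].
    by apply/funext => x /=; congr F; apply/ffunP => j; rewrite ffunE.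
  rewrite IHs (set_top_stretch k _ (craise s)).
  suff -> : F \o raise (k :: s) = F \o raise s \o set_coord k true by [].
  by apply/funext => x /=; rewrite raise_cons.
rewrite (step (enum 'I_n)).
suff -> : F \o raise (enum 'I_n) = (fun=> F (top n)) by [].
apply/funext => x /=; congr F; apply/ffunP => j.
by rewrite !ffunE mem_enum.
Qed.

(** Whether the top value of a cube may be replaced by [p] depends on the top
    value only, and not on the rest of the cube. *)
Lemma set_top_transport n (E F : cube n -> X 0) p :
  is_cube E -> is_cube F -> E (top n) = F (top n) ->
  is_cube (set_top E p) -> is_cube (set_top F p).
Proof.
move=> cE cF EF /(set_top_const _ cE) cEp.
by apply/(set_top_const _ cF); rewrite -EF.
Qed.

(** * Squares of spheres *)

Section Squares.
Variables (x0 : X 0) (m : nat).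

(** If [p] is [x0] this is the sphere with value [q] at the top vertex. *)
Definition edge (p q : X 0) (x : cube m.+1) : X 0 :=
  if ones_from 1 x then if x ord0 then q else p else x0.

Notation c0 := (ord0 : 'I_m.+2).
Notation c1 := (lift ord0 ord0 : 'I_m.+2).

(** A 2-cube of the iterated loop object of [X]: its corners are the values at
    the points whose last coordinates are all 1, in the order 00, 01, 10, 11. *)
Definition square (p q r s : X 0) (x : cube m.+2) : X 0 :=
  if ones_from 2 x
  then if x c0 then if x c1 then s else r else if x c1 then q else p
  else x0.

Lemma topE (x : cube m.+2) : (x == top m.+2) = [&& ones_from 2 x, x c0 & x c1].
Proof.
rewrite -ones_from0 (ones_from_ord c0) (ones_from_ord c1) andbA andbC.
by [].
Qed.

Lemma square_set_top p q r s t :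
  set_top (square p q r s) t = square p q r t.
Proof.
apply/funext => x; rewrite /set_top /square topE.
by case: ones_from => //=; case: (x c0); case: (x c1).
Qed.

Lemma edge_top p q : edge p q (top _) = q.
Proof.
rewrite /edge; case: ones_fromP => [_|[]] => [|k _]; by rewrite ffunE.
Qed.

Lemma square_top p q r s : square p q r s (top _) = s.
Proof. by have := topE (top _); rewrite eqxx /square => /esym/and3P[-> -> ->]. Qed.

Lemma edge_set_top p v : edge x0 p v = set_top (fun=> x0) p v.
Proof.
rewrite /set_top /edge -ones_from0 (ones_from_ord ord0) andbC.
by case: ones_from; case: (v ord0).
Qed.

Lemma square_face p q r s (i : 'I_m.+2) x :
  square p q r s (face i x) =
    match nat_of_ord i with 0 => edge p q x | 1 => edge p r x | _ => x0 end.
Proof.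
rewrite /square /edge; case: (ltnP i 2) => [|i2]; last first.
  by rewrite ones_from_face_lt //; case: (nat_of_ord i) i2 => [|[]].
case: (unliftP ord0 i) => [j ->|->] /=.
  rewrite /bump /= add1n !ltnS leqn0 => /eqP j0.
  have {j j0} -> : j = ord0 by apply: val_inj.
  rewrite ones_from_face // !ffunE unlift_none.
  have -> : c0 = lift c1 ord0 by apply: val_inj.
  by rewrite liftK.
move=> _; rewrite ones_from_face // !ffunE unlift_none.
by rewrite liftK.
Qed.

Lemma square_dup p q r v : square x0 p q r (dup m.+1 v) = edge x0 r v.
Proof.
have dupE k : dup m.+1 v k = v (inord k.-1).
  rewrite ffunE; have km : k.-1 < m.+1 by case: k => -[|k] /=.
  by rewrite insubT /=; congr (v _); apply: val_inj; rewrite /= inordK.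
have v0 : v (inord 0) = v ord0 by congr (v _); apply: val_inj; rewrite /= inordK.
rewrite /square /edge !dupE /= v0.
have -> : ones_from 2 (dup m.+1 v) = ones_from 1 v.
  apply/ones_fromP/ones_fromP => vd k kd.
    have kE : inord (lift ord0 k).-1 = k by exact: inord_val.
    by rewrite -kE -dupE; apply: vd.
  rewrite dupE; apply: vd; rewrite /= inordK; first by lia.
  by case: k kd => -[|k] /=.
by case: (v ord0); case: ones_from.
Qed.

Definition sq p q r s := is_cube (square p q r s).

Lemma edge_flip p q : is_cube (edge p q) -> is_cube (edge q p).
Proof.
move=> /(is_cube_flip ord0)[c cE]; exists c => x.
rewrite cE /edge set_coordE (@ones_from_ext _ 1 _ x); last first.
  by move=> k k1; rewrite ffunE; case: eqP => // kE; rewrite kE in k1.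
by case: (x ord0).
Qed.

Lemma sq_degenerate p q : is_cube (edge p q) -> sq p q p q.
Proof.
move=> cpq; pose f (x : cube m.+2) : cube m.+1 := [ffun j => x (lift ord0 j)].
apply: (is_cube_pullback (f := f) _ cpq) => [j|x].
  by exists (Some (lift ord0 j)), false => x; rewrite ffunE addbF.
rewrite /edge /square /= ffunE.
have -> : ones_from 1 (f x) = ones_from 2 x.
  apply/ones_fromP/ones_fromP => H k k1; last by rewrite ffunE; apply: H.
  case: (unliftP ord0 k) k1 => [j ->|->//] j1.
  by have := H j j1; rewrite ffunE.
by case: (x c0).
Qed.

Lemma sq_flip p q r s : sq p q r s -> sq r s p q.
Proof.
move=> /(is_cube_flip c0)[c cE]; exists c => x.
rewrite cE /square set_coordE (@ones_from_ext _ 2 _ x); last first.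
  by move=> k k1; rewrite ffunE; case: eqP => // kE; rewrite kE in k1.
by rewrite ffunE; case: (x c0).
Qed.

Lemma sq_transpose p q r s : sq p q r s -> sq p r q s.
Proof.
move=> cF.
apply: (is_cube_pullback
  (f := fun x => [ffun k => x (tperm c0 c1 k)] : cube m.+2) _ cF).
  by move=> k; exists (Some (tperm c0 c1 k)), false => x; rewrite ffunE addbF.
move=> x; rewrite /square /= (@ones_from_ext _ 2 _ x); last first.
  by move=> k k1; rewrite ffunE tpermD //; apply/eqP => kE; rewrite -kE in k1.
by rewrite !ffunE tpermL tpermR; case: (x c0); case: (x c1).
Qed.

Lemma sq_glue p q r s t u : sq p q r s -> sq r s t u -> sq p q t u.
Proof.
move=> cF cG; have [x|c cE] := glue (k := c0) cF cG.
  rewrite /square !set_coordE !ffunE /=.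
  rewrite (@ones_from_ext _ 2 _ x) 1?(@ones_from_ext _ 2 (set_coord _ _ _) x) //;
    by move=> k k1; rewrite ffunE; case: eqP => // kE; rewrite kE in k1.
by exists c => x; rewrite cE /square; case: (x c0).
Qed.

Lemma sq_complete p q r :
  is_cube (edge p q) -> is_cube (edge p r) -> exists s, sq p q r s.
Proof.
move=> cq cr; have [i|G cG GE] := corner_completion (F := square p q r x0).
  case iE: (nat_of_ord i) => [|[|k]].
  - by have [c cE] := cq; exists c => x; rewrite cE /= square_face iE.
  - by have [c cE] := cr; exists c => x; rewrite cE /= square_face iE.
  - have [c cE] := is_cube_const x0 m.+1.
    by exists c => x; rewrite cE /= square_face iE.
exists (G (top _)); have [c cE] := cG; exists c => x; rewrite cE.
by rewrite -(square_set_top _ _ _ x0) /set_top; case: eqP => [->//|/eqP/GE].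
Qed.

(** * The calculus of squares *)

(** The square with rows [(x0, p)] and [(x0, q)] expresses equivalence of the
    spheres with top values [p] and [q], by [sphere_equivP]; the square with
    rows [(x0, p)] and [(q, r)] says that [r] is a product of [p] and [q]. *)
Notation same p q := (sq x0 p x0 q).

Lemma sq_glue_col p q r s t u : sq p q r s -> sq q t s u -> sq p t r u.
Proof.
move=> /sq_transpose pq /sq_transpose qt.
exact: sq_transpose (sq_glue pq qt).
Qed.

Lemma same_trans p q r : same p q -> same q r -> same p r.
Proof. exact: sq_glue. Qed.

Lemma same_sym p q : same p q -> same q p.
Proof. exact: sq_flip. Qed.

Lemma sq_same_l p p' q r : same p p' -> sq x0 p q r -> sq x0 p' q r.
Proof. by move=> /same_sym pp'; apply: sq_glue. Qed.

Lemma sq_same_r p q q' r : same q q' -> sq x0 p q r -> sq x0 p q' r.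
Proof.
by move=> qq' /sq_transpose pqr; apply/sq_transpose/(sq_same_l qq').
Qed.

(** The two product squares, glued along the row [(x0, p)], give a square with
    rows [(q, r)] and [(q, r')]; a degenerate square moves [q] to [x0]. *)
Lemma sq_unique p q r r' :
  is_cube (edge x0 q) -> sq x0 p q r -> sq x0 p q r' -> same r r'.
Proof.
move=> cq /sq_flip pqr pqr'.
exact: sq_glue_col (sq_degenerate cq) (sq_glue pqr pqr').
Qed.

(** The squares for [d * c] and [b * c] share the edge from [x0] to [c]; gluing
    along it gives the square with rows [(b, d)] and [(e, f)], whose first row
    is the second row of the square for [a * b]. *)
Lemma sq_assoc a b c d e f :
  sq x0 a b d -> sq x0 d c f -> sq x0 b c e -> sq x0 a e f.
Proof.
move=> abd /sq_transpose dcf /sq_transpose/sq_flip bce.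
exact: sq_glue abd (sq_transpose (sq_glue bce dcf)).
Qed.

Lemma edge_diag p q r : sq x0 p q r -> is_cube (edge x0 r).
Proof.
move=> [c cE]; exists (restr (dup m.+1) c) => v.
by rewrite vertex_restr cE square_dup.
Qed.

(** The fourth corner of a square of which both edges at a corner [p] lead to
    [x0] is an inverse of [p]. *)
Lemma sq_inverse p : is_cube (edge x0 p) ->
  exists2 q, is_cube (edge x0 q) & sq x0 q p x0.
Proof.
move=> /edge_flip cp; have [q] := sq_complete cp cp.
move=> /sq_flip sq1; exists q => //.
have [c cE] := sq1; exists (restr (face c0) c) => v.
by rewrite vertex_restr cE square_face.
Qed.

(** * The homotopy group *)

Notation sphere := (sphere x0 m.+1).

Definition tip (a : sphere) : X 0 := vertex (sval a) (top _).

Lemma vertex_sphere (a : sphere) : vertex (sval a) =1 edge x0 (tip a).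
Proof.
move=> v; rewrite edge_set_top /set_top; case: eqP => [->//|/eqP].
by move=> vt; have /is_sphereP := svalP a; apply.
Qed.

Lemma edge_sphere (a : sphere) : is_cube (edge x0 (tip a)).
Proof. by exists (sval a); apply: vertex_sphere. Qed.

Lemma sphere_of_edge c p :
  vertex c =1 edge x0 p -> exists2 a : sphere, sval a = c & tip a = p.
Proof.
move=> cE; have sc : is_sphere x0 c.
  by apply/is_sphereP => v /negbTE vt; rewrite cE edge_set_top /set_top vt.
by exists (exist _ c sc) => //; rewrite /tip cE edge_top.
Qed.

(** In the equivalence of spheres the rest of the two cubes is arbitrary; it is
    [set_top_transport] that replaces it by the degenerate square on [a]. *)
Lemma sphere_equivP (a b : sphere) :
  sphere_equiv a b <-> same (tip a) (tip b).
Proof.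
split=> [[e [f [/on_corner_eqP ef ea fb]]]|abq].
  have top_dup : dup m.+1 (top _) = top _.
    apply/ffunP => k; rewrite !ffunE.
    case: insubP => [j _ _|/negP[]]; first by rewrite ffunE.
    by case: k => -[|k].
  have etip : vertex e (top _) = tip a by rewrite /tip -ea vertex_restr top_dup.
  have ftip : vertex f (top _) = tip b by rewrite /tip -fb vertex_restr top_dup.
  rewrite /sq -(square_set_top _ _ _ (tip a)).
  apply: (set_top_transport (E := vertex e)); first by exists e.
  - exact: sq_degenerate (edge_sphere a).
  - by rewrite etip square_top.
  - exists f => v; rewrite /set_top; case: eqP => [->//|/eqP/ef//].
have [e eE] := sq_degenerate (edge_sphere a); have [f fE] := abq.
exists e, f; split.
- apply/on_corner_eqP => v /negbTE vt; rewrite eE fE.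
  by rewrite -(square_set_top _ _ _ (tip b)) /set_top vt.
- by apply: vertex_inj => v; rewrite vertex_restr eE square_dup vertex_sphere.
- by apply: vertex_inj => v; rewrite vertex_restr fE square_dup vertex_sphere.
Qed.

Lemma sphere_equivalence : Equivalence (@sphere_equiv X x0 m.+1).
Proof.
split=> [a|a b|a b c]; rewrite !sphere_equivP.
- exact: sq_degenerate (edge_sphere a).
- exact: same_sym.
- exact: same_trans.
Qed.

Notation class := (@homotopy_class X x0 m.+1).

Lemma homotopy_classP (a b : sphere) :
  class a = class b <-> same (tip a) (tip b).
Proof.
have eqv := sphere_equivalence; rewrite -sphere_equivP; split=> [ab|ab].
  have : sphere_class b b by exact: reflexivity.
  by have /= <- := congr1 sval ab.
have E : sphere_class a = sphere_class b.
  apply/seteqP; split=> c /= h; first by transitivity a => //; symmetry.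
  by transitivity b.
exact: eq_exist.
Qed.

Lemma homotopy_class_surj C : exists a, C = class a.
Proof.
case: C => C [a CE]; exists a; exact: eq_exist.
Qed.

Lemma product_completionP a b (e : X m.+2) :
  product_completion a b e <->
  exists r, vertex e =1 square x0 (tip a) (tip b) r.
Proof.
split=> [[phi phiE ephi]|[r eE]].
  exists (vertex e (top _)) => v; have [->|] := eqVneq v (top _).
    by rewrite square_top.
  move=> /neq_top[i /face_surj[x ->]].
  rewrite -vertex_restr square_face.
  have := phiE i; rewrite -ephi /= => ->.
  case: (nat_of_ord i) => [|[|k]]; rewrite ?vertex_sphere //.
  exact: vertex_const_cube.
exists (on_corner e) => // i /=; apply: vertex_inj => x.
rewrite vertex_restr eE square_face.
by case: (nat_of_ord i) => [|[|k]]; rewrite ?vertex_sphere // vertex_const_cube.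
Qed.

Lemma sphere_product_exists (a b : sphere) :
  exists c : sphere, sq x0 (tip a) (tip b) (tip c).
Proof.
have [r abr] := sq_complete (edge_sphere a) (edge_sphere b).
have [c /sphere_of_edge[s _ sr]] := edge_diag abr.
by exists s; rewrite sr.
Qed.

(** The quantification over all representatives and completions makes the
    product of classes well defined. *)
Lemma class_product_exists C D : exists E, forall a b c : sphere,
  C = class a -> D = class b -> sq x0 (tip a) (tip b) (tip c) -> E = class c.
Proof.
have [a ->] := homotopy_class_surj C; have [b ->] := homotopy_class_surj D.
have [c abc] := sphere_product_exists a b.
exists (class c) => a' b' c' /homotopy_classP aa' /homotopy_classP bb' abc'.
apply/homotopy_classP; apply: (sq_unique (edge_sphere b')) abc'.
exact: sq_same_l aa' (sq_same_r bb' abc).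
Qed.

Lemma homotopy_group :
  exists mul : homotopy_set x0 m.+1 -> homotopy_set x0 m.+1 -> homotopy_set x0 m.+1,
    is_completion_product mul /\ is_abelian_group mul.
Proof.
have [mul mulP] : exists mul : homotopy_set x0 m.+1 -> homotopy_set x0 m.+1 ->
    homotopy_set x0 m.+1, forall a b c,
    sq x0 (tip a) (tip b) (tip c) -> mul (class a) (class b) = class c.
  exists (fun C D => sval (cid (class_product_exists C D))) => a b c.
  by case: cid => E /= EP /EP; apply.
have [base _ tip_base] : exists2 o : sphere, sval o = const_cube x0 _ & tip o = x0.
  apply: sphere_of_edge => v; rewrite vertex_const_cube /edge.
  by case: ifP => //; case: ifP.
have mulC a b : mul (class a) (class b) = mul (class b) (class a).
  have [c abc] := sphere_product_exists a b.
  by rewrite (mulP _ _ _ abc) (mulP _ _ _ (sq_transpose abc)).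
exists mul; split; first split=> [a b|a b e /product_completionP[r eE]].
- have [r [e eE]] := sq_complete (edge_sphere a) (edge_sphere b).
  by exists e; apply/product_completionP; exists r.
- have [c cE ctip] : exists2 c : sphere, sval c = restr (dup m.+1) e & tip c = r.
    by apply: sphere_of_edge => v; rewrite vertex_restr eE square_dup.
  by exists c => //; apply: mulP; exists e; rewrite ctip.
split=> [C D E|C D|].
- have [a ->] := homotopy_class_surj C; have [b ->] := homotopy_class_surj D.
  have [c ->] := homotopy_class_surj E.
  have [d abd] := sphere_product_exists a b.
  have [e bce] := sphere_product_exists b c.
  have [f dcf] := sphere_product_exists d c.
  rewrite (mulP _ _ _ abd) (mulP _ _ _ bce) (mulP _ _ _ dcf).
  exact/mulP/(sq_assoc abd dcf bce).
- have [a ->] := homotopy_class_surj C; have [b ->] := homotopy_class_surj D.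
  exact: mulC.
have /choice[inv invP] C : exists D, mul D C = class base.
  have [a ->] := homotopy_class_surj C.
  have [q [c cq] qa] := sq_inverse (edge_sphere a).
  have [b _ bq] := sphere_of_edge cq.
  by exists (class b); apply: mulP; rewrite bq tip_base.
exists (class base), inv; split=> [C|C]; last exact: invP.
have [a ->] := homotopy_class_surj C; rewrite mulC; apply: mulP.
by rewrite tip_base; apply/sq_degenerate/edge_sphere.
Qed.

End Squares.

End Vertices.

Theorem mainTheorem9 (X : cubeset) (fibX : fibrant X) (concX : concrete X)
    (x0 : X 0) (n : nat) (n_gt0 : 0 < n) :
  Equivalence (@sphere_equiv X x0 n) /\
  exists mul : homotopy_set x0 n -> homotopy_set x0 n -> homotopy_set x0 n,
    is_completion_product mul /\ is_abelian_group mul.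
Proof.
case: n n_gt0 => // m _; split; first exact: sphere_equivalence.
exact: homotopy_group.
Qed.
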